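(* Let $n\ge 1$ and let $S\subseteq U_{6n}$ with $1\notin S=S^{-1}$. Write $S=S_1\cup S_2$ where $S_1=S\cap\left(\langle a^2\rangle\cup\langle a^2\rangle b\cup\langle a^2\rangle b^2\right)$ and $S_2=S\cap\left(\langle a^2\rangle a\cup\langle a^2\rangle ab\cup\langle a^2\rangle ab^2\right)$. Then $\mathrm{Cay}(U_{6n},S)$ is integral if and only if both of the following hold for all $0\le j\le 2n-1$ and $0\le k\le n-1$: (1) $\chi_j(S)$, $\psi_k(S_1)$ and $\psi_k(S_1^2)+\psi_k(S_2^2)$ are integers; (2) $\Delta_{\psi_k}(S):=2\left(\psi_k(S_1^2)+\psi_k(S_2^2)\right)-\psi_k(S_1)^2$ is a perfect square (the square of an integer).
   Context: For an integer $n\ge1$, $U_{6n}=\langle a,b\mid a^{2n}=b^3=1,\ a^{-1}ba=b^{-1}\rangle$, a group of order $6n$ whose elements are uniquely $a^ib^\epsilon$ with $0\le i\le 2n-1$, $\epsilon\in\{0,1,2\}$. Let $\omega=\exp(\pi\imath/n)$. Its irreducible complex characters are: the $2n$ linear characters $\chi_j$ ($0\le j\le 2n-1$) given by $\chi_j(a^{2r}b^\epsilon)=\omega^{2jr}$ and $\chi_j(a^{2r+1}b^\epsilon)=\omega^{j(2r+1)}$ for all $\epsilon\in\{0,1,2\}$; and the $n$ degree-two characters $\psi_k$ ($0\le k\le n-1$) given by $\psi_k(a^{2r})=2\omega^{2kr}$, $\psi_k(a^{2r}b)=\psi_k(a^{2r}b^2)=-\omega^{2kr}$, $\psi_k(a^{2r+1}b^\epsilon)=0$.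 For a character $\chi$ and subsets $A,B$ of a group, $\chi(A)=\sum_{x\in A}\chi(x)$ (with $\chi(\emptyset)=0$) and $\chi(A^2)=\sum_{x_1,x_2\in A}\chi(x_1x_2)$, the sum running over all ordered pairs. For a group $G$ and $S\subseteq G$ with $1\notin S=S^{-1}$, the Cayley graph $\mathrm{Cay}(G,S)$ has vertex set $G$ and edges $\{g,sg\}$ for $g\in G,s\in S$. A graph is integral if all eigenvalues of its adjacency matrix are integers. *)

(* Defs.v *)
From HB Require Import structures.
From mathcomp Require Import all_boot all_order all_algebra all_field.
Set Implicit Arguments. Unset Strict Implicit. Unset Printing Implicit Defensive.
Import Order.TTheory GRing.Theory Num.Theory.
Local Open Scope ring_scope.

(* U_{6n}: the element a^i b^e is encoded as the pair (i, e) with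
   i : 'Z_(2n) (i.e. 0 <= i <= 2n-1, for n >= 1) and e : 'Z_3.
   Since b^e a^j = a^j b^(e * (-1)^j), the product is
   (i, e) * (j, f) = (i + j, (-1)^j e + f). *)
Notation U6 n := ('Z_(2 * n) * 'Z_3)%type.

Definition umul (n : nat) (x y : U6 n) : U6 n :=
  (x.1 + y.1, (if odd y.1 then - x.2 else x.2) + y.2).

Definition uone (n : nat) : U6 n := (0, 0).

Definition uinvset (n : nat) (S : {set U6 n}) : {set U6 n} :=
  [set y | [exists x in S, umul x y == uone n]].

(* omega = exp(pi i / n): in algC, n.-root (-1) is the n-th root of -1 of
   minimal nonnegative argument, i.e. exp(pi i / n). *)
Definition omega (n : nat) : algC := n.-root (-1).

Definition chi (n j : nat) (x : U6 n) : algC := omega n ^+ (j * x.1).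

Definition psi (n k : nat) (x : U6 n) : algC :=
  if odd x.1 then 0
  else (if x.2 == 0 then 2 else -1) * omega n ^+ (k * x.1).

Definition cfset (n : nat) (f : U6 n -> algC) (A : {set U6 n}) : algC :=
  \sum_(x in A) f x.
Definition cfsq (n : nat) (f : U6 n -> algC) (A : {set U6 n}) : algC :=
  \sum_(x in A) \sum_(y in A) f (umul x y).

Definition Spart1 (n : nat) (S : {set U6 n}) : {set U6 n} :=
  [set x in S | ~~ odd x.1].
Definition Spart2 (n : nat) (S : {set U6 n}) : {set U6 n} :=
  [set x in S | odd x.1].

Definition cay_adj (n : nat) (S : {set U6 n}) : 'M[algC]_#|{: U6 n}| :=
  \matrix_(i, j)
    (if [exists s in S, umul s (enum_val i) == enum_val j] then 1 else 0).

Definition integral_cayley (n : nat) (S : {set U6 n}) : Prop :=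
  forall lam : algC, eigenvalue (cay_adj S) lam -> lam \in Num.int.

(* Main.v *)
(* The adjacency matrix is left multiplication by [\sum_(s in S) s] on the group
   algebra, so its eigenvalues are those of the matrices [\sum_(s in S) r s], for
   [r] running over the irreducible representations. The one-dimensional ones
   give the numbers [chi_j(S)]; a two-dimensional one gives a 2 x 2 matrix [M]
   with [\tr M = psi_k(S_1)] and [\tr (M^2) = psi_k(S_1^2) + psi_k(S_2^2)], whose
   eigenvalues are [(\tr M +- sqrt (2 \tr (M^2) - (\tr M)^2)) / 2]. These are
   integers iff both traces are and the discriminant is a square, the division
   by 2 being exact since [t^2 + m^2] even forces [t + m] even. *)
Require Import Defs.
From HB Require Import structures.
From mathcomp Require Import all_boot all_order all_algebra all_field.
From mathcomp Require Import ring zify.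
Import Order.TTheory GRing.Theory Num.Theory.
Local Open Scope ring_scope.

(** * Primitivity of [omega n] *)

Lemma normC_unity_root (m : nat) (y : algC) :
  (0 < m)%N -> y ^+ m = 1 -> `|y| = 1.
Proof.
by move=> m0 ym; apply/eqP; rewrite -(pexpr_eq1 m0) // -normrX ym normr1.
Qed.

(** The arguments [t] of [w] and [u] of [y] satisfy [0 < t < u <= pi], so [u - 2 t] lies strictly
    between [-u] and [u] and has the larger cosine. *)
Lemma Re_rotate_gt (w y : algC) :
  `|w| = 1 -> `|y| = 1 -> 0 < 'Im w -> 0 <= 'Im y -> 'Re y < 'Re w ->
  'Re y < 'Re (y * (w^*) ^+ 2).
Proof.
move=> nw ny; have := normC2_Re_Im w; have := normC2_Re_Im y.
rewrite nw ny expr1n expr2 !(ReM, ImM) !Re_conj !Im_conj.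
set c := 'Re w; set s := 'Im w; set C := 'Re y; set T := 'Im y.
move=> E2 E1 s0 T0 cC.
have cC' : 0 < c - C by rewrite subr_gt0.
have sT0 : 0 < s + T by rewrite ltr_wpDr.
(* An identity modulo the two norm equations. Its right-hand side is visibly positive, which gives
   the sign of [T * c - C * s] without angles. *)
have F : (2 * (s + T)) * (T * c - C * s) =
         (c - C) * ((c + C) ^+ 2 + (s + T) ^+ 2).
  have -> : (2 * (s + T)) * (T * c - C * s) =
         (c - C) * ((c + C) ^+ 2 + (s + T) ^+ 2)
      + (2 * c - (c - C)) * (C ^+ 2 + T ^+ 2 - 1)
      - (2 * C + (c - C)) * (c ^+ 2 + s ^+ 2 - 1) by ring.
  by rewrite -E1 -E2 !subrr !mulr0 addr0 subr0.
(* With arguments [t] of [w] and [u] of [y], this is [sin (u - t) > 0], and the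
   difference of the real parts to be compared is [2 sin t sin (u - t)]. *)
have G : 0 < T * c - C * s.
  have P2 : 0 < 2 * (s + T) by rewrite mulr_gt0 ?ltr0n.
  rewrite -(pmulr_rgt0 _ P2) F.
  rewrite mulr_gt0 // ltr_wpDl ?exprn_gt0 //.
  by rewrite real_exprn_even_ge0 // rpredD // Creal_Re.
rewrite -subr_gt0.
have <- : 2 * s * (T * c - C * s) =
   C * (c * c - - s * - s) - T * (c * - s + c * - s) - C.
  have CE : C = C * (c ^+ 2 + s ^+ 2) by rewrite -E1 mulr1.
  rewrite [X in _ = _ - X]CE; ring.
by rewrite mulr_gt0 // mulr_gt0 ?ltr0n.
Qed.

(* Rotating a root of [-1] by [w^-2], where [w] has maximal real part, brings it
   closer to [1] without changing membership in the group generated by [w]; so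
   a root outside this group cannot have maximal real part. *)
Lemma omega_prim (n : nat) :
  (0 < n)%N -> (2 * n).-primitive_root (omega n).
Proof.
move=> n0; have n20 : (0 < 2 * n)%N by rewrite muln_gt0.
have wn : omega n ^+ n = -1 by rewrite /omega rootCK.
have w2n : omega n ^+ (2 * n) = 1 by rewrite mulnC exprM wn sqrrN expr1n.
have nw := normC_unity_root _ _ n20 w2n.
have [z zP] := C_prim_root_exists n20.
have norm1 (y : algC) : y ^+ n = -1 -> `|y| = 1.
  move=> yn; apply: (normC_unity_root _ _ n20).
  by rewrite mulnC exprM yn sqrrN expr1n.
pose inw (y : algC) := [exists k : 'I_(2 * n), y == omega n ^+ k].
have inwX k : inw (omega n ^+ k).
  apply/existsP; exists (Ordinal (ltn_pmod k n20)) => /=.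
  by rewrite expr_mod.
have wN0 : omega n != 0 by rewrite -normr_eq0 nw oner_eq0.
have wV : (omega n)^* = (omega n)^-1 by rewrite invC_norm nw expr1n invr1 mul1r.
have inwM y : inw (y * (omega n)^* ^+ 2) -> inw y.
  case/existsP=> k /eqP yE; have -> : y = omega n ^+ (k + 2); last exact: inwX.
  by rewrite exprD -yE wV exprVn mulfVK // expf_neq0.
have inwC y : inw y^* -> inw y.
  case/existsP=> k /eqP yE; have -> : y = omega n ^+ (2 * n - k); last exact: inwX.
  apply: (mulIf (expf_neq0 k wN0)); rewrite -exprD subnK ?w2n; last exact: ltnW.
  apply: (can_inj (@conjCK _)).
  by rewrite rmorphM /= yE rmorphXn /= wV exprVn divff ?expf_neq0 // rmorph1.
have all_in (y : algC) : y ^+ n = -1 -> inw y.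
  move=> yn; apply: contraT => ninw.
  have y2n : y ^+ (2 * n) = 1 by rewrite mulnC exprM yn sqrrN expr1n.
  have [j yE] := prim_rootP zP y2n.
  pose P (i : 'I_(2 * n)) := ((z ^+ i) ^+ n == -1) && ~~ inw (z ^+ i).
  have Pj : P j by rewrite /P -yE yn eqxx.
  have Rreal : {in P, forall i : 'I_(2 * n), 'Re (z ^+ i) \is Num.real}.
    by move=> i _; exact: Creal_Re.
  have [i] := real_arg_maxP Pj Rreal.
  rewrite /P => /andP[/eqP un nu] umax.
  have {}umax (x : algC) : x ^+ n = -1 -> ~~ inw x -> 'Re x <= 'Re (z ^+ i).
    move=> xn nx; have x2n : x ^+ (2 * n) = 1 by rewrite mulnC exprM xn sqrrN expr1n.
    have [l xE] := prim_rootP zP x2n.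
    by rewrite xE; apply: umax; rewrite -xE xn eqxx.
  have [u [{}un {}nu Iu {}umax]] : exists u : algC, [/\ u ^+ n = -1, ~~ inw u,
      0 <= 'Im u & forall x : algC, x ^+ n = -1 -> ~~ inw x -> 'Re x <= 'Re u].
    (* Conjugation preserves the real part and non-membership, so the maximiser may be taken in the
       upper half plane, where [rootC_Re_max] compares it with [omega n]. *)
    case: (real_ge0P (Creal_Im (z ^+ i))) => [I0|/ltW I0].
      by exists (z ^+ i).
    exists (z ^+ i)^*; rewrite Im_conj oppr_ge0 Re_conj; split=> //.
      by rewrite -rmorphXn /= un rmorphN1.
    by apply: contra nu; exact: inwC.
  have uw : u != omega n by apply: contraNneq nu => ->; rewrite -(expr1 (omega n)).
  have Rle : 'Re u <= 'Re (omega n) by exact: rootC_Re_max.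
  have [n1|n1] := leqP n 1.
    have n1' : n = 1%N by apply/eqP; rewrite eqn_leq n1.
    by move: uw; rewrite -[u]expr1 -[omega n]expr1 -n1' un wn eqxx.
  have Iw : 0 <= 'Im (omega n) by exact: Im_rootC_ge0.
  have nu1 := norm1 _ un.
  have Rlt : 'Re u < 'Re (omega n).
    rewrite lt_neqAle Rle andbT; apply: contraNneq uw => RE.
    rewrite eqC RE eqxx /= -(eqrXn2 (ltn0Sn 1)) //.
    apply/eqP/(addrI ('Re u ^+ 2)); rewrite {2}RE -!normC2_Re_Im.
    by rewrite nu1 nw.
  (* A real [omega n] would be [1], which is no root of [-1], or [-1], whose real part is minimal on
     the unit circle. *)
  have Iw0 : 0 < 'Im (omega n).
    rewrite lt_neqAle Iw andbT eq_sym; apply: contraTneq Rlt => I0.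
    have wR : omega n = 'Re (omega n) by rewrite [LHS]Crect I0 mulr0 addr0.
    have := normC2_Re_Im (omega n); rewrite nw I0 expr0n addr0 expr1n => /esym/eqP.
    rewrite sqrf_eq1 => /orP[] /eqP RE.
      by move: wn; rewrite wR RE expr1n => /eqP; rewrite -addr_eq0 (eqr_nat _ 2 0).
    rewrite RE -real_leNgt ?rpredN1 ?Creal_Re //.
    have := (leif_normC_Re_Creal u).1.
    by rewrite nu1 real_ler_norml ?Creal_Re // => /andP[].
  have := Re_rotate_gt _ _ nw nu1 Iw0 Iu Rlt.
  rewrite real_ltNge ?Creal_Re // => /negP[]; apply: umax.
    rewrite exprMn un -exprM mulnC exprM -rmorphXn /= wn rmorphN1.
    by rewrite sqrrN expr1n mulr1.
  by apply: contra nu; exact: inwM.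
(* A primitive root [z] of order [2 * n] is itself a root of [-1], hence a power of [omega n]; so
   [2 * n] divides the order [m] of [omega n]. *)
have zn : z ^+ n = -1.
  have : (z ^+ n) ^+ 2 == 1 by rewrite -exprM mulnC prim_expr_order.
  rewrite sqrf_eq1 -(prim_order_dvd zP) => /orP[|/eqP//].
  by move=> /(dvdn_leq n0); lia.
have /existsP[k /eqP zE] := all_in _ zn.
have [m mP] := prim_order_exists n20 w2n.
move=> mn; suff -> : (2 * n)%N = m by [].
apply/eqP; rewrite eqn_dvd mn andbT (prim_order_dvd zP) zE exprAC.
by rewrite (prim_expr_order mP) expr1n.
Qed.

(** * Linear algebra: eigenvalues, small matrices, the finite Fourier transform *)

Lemma eigenvalue_det (F : fieldType) (d : nat) (M : 'M[F]_d) (a : F) :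
  eigenvalue M a = (\det (M - a%:M) == 0).
Proof.
apply/eigenvalueP/det0P=> [[v Mv v0] | [v v0 Mv]]; exists v => //.
  by rewrite mulmxBr Mv mul_mx_scalar subrr.
by apply/eqP; rewrite -mul_mx_scalar -subr_eq0 -mulmxBr Mv.
Qed.

(** Several columns are allowed so that the matrix-valued Fourier transform of an eigenvector can
    serve as [X]. *)
Lemma eigenvalue_col (F : fieldType) (d e : nat) (M : 'M[F]_d)
    (X : 'M[F]_(d, e)) (a : F) :
  M *m X = a *: X -> X != 0 -> eigenvalue M a.
Proof.
move=> MX; apply: contraNT; rewrite eigenvalue_det => dN0.
have U : M - a%:M \in unitmx by rewrite unitmxE unitfE.
by rewrite -(mulKmx U X) mulmxBl MX mul_scalar_mx subrr mulmx0.
Qed.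

Lemma eigenvalue_mx11 (F : fieldType) (M : 'M[F]_1) (a : F) :
  eigenvalue M a = (a == M 0 0).
Proof.
by rewrite eigenvalue_det det_mx11 !mxE eqxx mulr1n subr_eq0 eq_sym.
Qed.

(** Completing the square: since [2 det M = (tr M)^2 - tr (M^2)], the difference of the two sides is
    [4 det (M - a)]. *)
Lemma eigenvalue_mx22 (F : numFieldType) (M : 'M[F]_2) (a : F) :
  eigenvalue M a = ((2 * a - \tr M) ^+ 2 == 2 * \tr (M *m M) - (\tr M) ^+ 2).
Proof.
rewrite eigenvalue_det (expand_det_row _ 0) !big_ord_recl big_ord0 /cofactor.
rewrite !det_mx11 /mxtrace !big_ord_recl !big_ord0 !mxE !big_ord_recl !big_ord0 /=.
have e1 : lift (ord0 : 'I_2) (ord0 : 'I_1) = 1 by apply: val_inj.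
have e0 : lift (1 : 'I_2) (ord0 : 'I_1) = 0 by apply: val_inj.
have -> : (0 : 'I_2) = ord0 by [].
have -> : (0 : 'I_1) = ord0 by [].
rewrite !e1 !e0 -[LHS](mulrI_eq0 _ (mulfI (_ : 4 != 0 :> F))) ?pnatr_eq0 //.
rewrite -[RHS]subr_eq0.
set x := M _ _; set y := M _ _; set u := M _ _; set v := M _ _.
by congr (_ == _); rewrite mulr1n mulr0n /bump /=; ring.
Qed.

Lemma parity_sum_sqr (q t m : int) :
  2 * q - t ^+ 2 = m ^+ 2 -> exists b, t + m = 2 * b.
Proof.
move=> E; exists ((t + m) %/ 2)%Z.
have := divz_eq (t + m) 2; have := modz_ge0 (t + m) (isT : 2 != 0 :> int).
have := ltz_pmod (t + m) (isT : 0 < 2 :> int).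
move: ((t + m) %/ 2)%Z ((t + m) %% 2)%Z => b e e2 e0 D.
have [e1|e1] : e = 0 \/ e = 1 by lia.
  by rewrite D e1; lia.
have mE : m = 2 * b + 1 - t by lia.
nia.
Qed.

Lemma integral_mx22 (M : 'M[algC]_2) :
  (forall a, eigenvalue M a -> a \in Num.int) <->
  ((\tr M \in Num.int /\ \tr (M *m M) \in Num.int) /\
   exists m : int, 2 * \tr (M *m M) - (\tr M) ^+ 2 = m%:~R ^+ 2).
Proof.
have E2 := eigenvalue_mx22 _ M.
move: (\tr M) (\tr (M *m M)) E2 => t q E2; split.
  move=> intM; pose s := sqrtC (2 * q - t ^+ 2).
  have sE : s ^+ 2 = 2 * q - t ^+ 2 by rewrite sqrtCK.
  have a1 : (t + s) / 2 \in Num.int.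
    by apply: intM; rewrite E2 -sE; apply/eqP; field.
  have a2 : (t - s) / 2 \in Num.int.
    by apply: intM; rewrite E2 -sE; apply/eqP; field.
  (* The two eigenvalues have sum [t], difference [s] and sum of squares [q], so all three are
     integers. *)
  have tE : t = (t + s) / 2 + (t - s) / 2 by field.
  have sE' : s = (t + s) / 2 - (t - s) / 2 by field.
  have qE : q = ((t + s) / 2) ^+ 2 + ((t - s) / 2) ^+ 2.
    have -> : q = (s ^+ 2 + t ^+ 2) / 2 by rewrite sE; field.
    by field.
  have /intrP[m mE] : s \in Num.int by rewrite sE' rpredB.
  split; last by exists m; rewrite -sE mE.
  by rewrite qE {1}tE !(rpredD, rpredX).
case=> -[/intrP[t' tE] /intrP[q' qE]] [m]; rewrite tE qE => mE a.
have mEz : 2 * q' - t' ^+ 2 = m ^+ 2.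
  by apply: (@intr_inj algC); rewrite rmorphB rmorphM !rmorphXn.
rewrite E2 tE qE mE eqf_sqr => aE.
(* The sign of the square root is absorbed into [m'], leaving [2 a = t' + m'], which is even. *)
have [m' mE' aE'] : exists2 m' : int, 2 * q' - t' ^+ 2 = m' ^+ 2 &
    2 * a - t'%:~R = m'%:~R.
  case/orP: aE => /eqP aE; [exists m|exists (- m)]; rewrite ?sqrrN //.
  by rewrite aE rmorphN.
have [b bE] := parity_sum_sqr _ _ _ mE'.
have -> : a = b%:~R; last exact: intr_int.
have two0 : 2 != 0 :> algC by rewrite pnatr_eq0.
apply: (mulfI two0).
have := congr1 (fun x : int => x%:~R : algC) bE.
rewrite /= rmorphD rmorphM /= -aE' => <-.
ring.
Qed.

(** The polynomial with coefficients [f] has degree at most [N] but vanishes at the [N.+1] distinct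
    powers of [w]. *)
Lemma dft_inj (F : fieldType) (N : nat) (w : F) (f : 'I_N.+1 -> F) :
  N.+1.-primitive_root w ->
  (forall j, (j < N.+1)%N -> \sum_(i < N.+1) f i * w ^+ (j * i) = 0) ->
  forall i, f i = 0.
Proof.
move=> wP f0 i; pose p := \poly_(i < N.+1) f (inord i).
have p0 : p = 0.
  apply: (@roots_geq_poly_eq0 _ _ [seq w ^+ (nat_of_ord j) | j <- enum 'I_N.+1]).
  - apply/allP => _ /mapP[j _ ->]; rewrite rootE horner_poly.
    apply/eqP; rewrite -[RHS](f0 j (ltn_ord j)); apply: eq_bigr => l _.
    by rewrite inord_val exprM.
  - rewrite map_inj_uniq ?enum_uniq // => j l /eqP.
    by rewrite (eq_prim_root_expr wP) !modn_small // => /eqP/val_inj.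
  - by rewrite size_map size_enum_ord size_poly.
have := coef_poly N.+1 (fun i => f (inord i)) i.
by rewrite -/p p0 coef0 ltn_ord inord_val.
Qed.

(** * The spectrum of the Cayley graph through representations *)

Lemma umulI (n : nat) (g : U6 n) : injective (@umul n ^~ g).
Proof.
move=> [i e] [i' e'] E; have /addIr /= -> := congr1 fst E.
by have /addIr /= := congr1 snd E; case: ifP => _ => [/oppr_inj|] ->.
Qed.

(** By cancellation the neighbours [umul s g] of [g] are distinct, so no multiplicity is lost in the
    0/1 matrix. Values in a module cover both scalar and matrix-valued [f]. *)
Lemma cay_adj_sum (n : nat) (S : {set U6 n}) (V : lmodType algC) (f : U6 n -> V) i :
  \sum_j cay_adj S i j *: f (enum_val j) = \sum_(s in S) f (umul s (enum_val i)).
Proof.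
rewrite -(big_imset f (h := @umul n ^~ (enum_val i))) /=; last first.
  by move=> s s' _ _; exact: umulI.
rewrite [RHS]big_mkcond /=.
rewrite (big_enum_val (A := {: U6 n}) (fun h =>
  if h \in [set umul x (enum_val i) | x in S] then f h else 0)) /=.
apply: eq_bigr => j _; rewrite !mxE.
have -> : (enum_val j \in [set umul x (enum_val i) | x in S]) =
   [exists s in S, umul s (enum_val i) == enum_val j].
  apply/imsetP/exists_inP => [[s sS ->]|[s sS /eqP<-]]; first by exists s.
  by exists s.
by case: ifP => _; rewrite ?scale1r ?scale0r.
Qed.

Definition is_rep (n d : nat) (r : U6 n -> 'M[algC]_d) : Prop :=
  r (uone n) = 1%:M /\ forall x y, r (umul x y) = r x *m r y.

(** For a left eigenvector [u] with [u 0 c != 0], the coefficient function sending [g] to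
    [(u *m r g) 0 c] is an eigenvector of the graph, nonzero at the identity. *)
Lemma eigenvalue_rep_cay (n d : nat) (r : U6 n -> 'M[algC]_d) (S : {set U6 n}) a :
  is_rep n d r -> eigenvalue (\sum_(s in S) r s) a -> eigenvalue (cay_adj S) a.
Proof.
move=> [r1 rM] /eigenvalueP[u uM u0].
have /rV0Pn[c uc] := u0.
apply: (@eigenvalue_col _ _ 1 _ (\col_i (u *m r (enum_val i)) 0 c)).
  apply/colP => i; rewrite [LHS]mxE [RHS]mxE [in RHS]mxE.
  have := cay_adj_sum n S _ (fun g => ((u *m r g) 0 c : algC^o)) i.
  rewrite (eq_bigr (fun s => (u *m r s *m r (enum_val i)) 0 c)); last first.
    by move=> s _; rewrite rM mulmxA.
  rewrite -summxE -mulmx_suml -mulmx_sumr uM -scalemxAl [in RHS]mxE => <-.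
  by apply: eq_bigr => j _; rewrite [in LHS]mxE.
apply/eqP => /colP/(_ (enum_rank (uone n))).
by rewrite mxE [RHS]mxE enum_rankK r1 mulmx1 => /eqP; apply/negP.
Qed.

(** Left multiplication of the Fourier transform of [v] at [r] by the sum of the [r s] is the
    transform of [v *m cay_adj S], that is, [a] times the transform of [v]. *)
Lemma eigenvalue_cay_rep (n d : nat) (r : U6 n -> 'M[algC]_d) (S : {set U6 n})
    (v : 'rV_#|{: U6 n}|) a :
  is_rep n d r -> v *m cay_adj S = a *: v ->
  \sum_i v 0 i *: r (enum_val i) != 0 -> eigenvalue (\sum_(s in S) r s) a.
Proof.
move=> [_ rM] vA; apply: eigenvalue_col.
rewrite mulmx_sumr scaler_sumr.
transitivity (\sum_i \sum_j v 0 i *: (cay_adj S i j *: r (enum_val j))).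
  apply: eq_bigr => i _; rewrite -scaler_sumr cay_adj_sum -scalemxAr mulmx_suml.
  by congr (_ *: _); apply: eq_bigr => s _; rewrite rM.
rewrite exchange_big; apply: eq_bigr => j _ /=.
have /rowP/(_ j) := vA; rewrite !mxE scalerA => <-.
by rewrite scaler_suml; apply: eq_bigr => i _; rewrite scalerA.
Qed.

(** * The representations of [U6 n] and Fourier inversion *)

Lemma Zp_card (n : nat) : (0 < n)%N -> (Zp_trunc (2 * n)).+2 = (2 * n)%N.
Proof. by move=> n0; rewrite Zp_cast //; lia. Qed.

(** Reduction modulo the even number [2 * n] preserves parity. *)
Lemma odd_umul (n : nat) (x y : U6 n) : (0 < n)%N ->
  odd (umul x y).1 = odd x.1 (+) odd y.1.
Proof.
by move=> n0; rewrite /umul /= odd_mod ?oddD // Zp_card // oddM.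
Qed.

Lemma omega_umul (n k : nat) (x y : U6 n) : (0 < n)%N ->
  omega n ^+ (k * (umul x y).1) = omega n ^+ (k * x.1) * omega n ^+ (k * y.1).
Proof.
move=> n0; have wP := omega_prim n n0; rewrite -(Zp_card n n0) in wP.
rewrite ![(k * _)%N]mulnC !exprM -exprMn -exprD /umul /=.
by rewrite (prim_expr_mod wP).
Qed.

(* The representation [a |-> omega^k P], [b |-> diag (z, z^2)], where [P] swaps
   the two basis vectors and [z] is a primitive cube root of unity. *)
Definition rho (n : nat) (z : algC) (k : nat) (x : U6 n) : 'M[algC]_2 :=
  \matrix_(r, c) (if odd (r + c) == odd x.1
                  then omega n ^+ (k * x.1) * z ^+ (x.2 * c.+1) else 0).

Lemma chi_rep (n j : nat) : (0 < n)%N -> is_rep n 1 (fun x => (chi j x)%:M).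
Proof.
move=> n0; split; first by rewrite /chi muln0.
by move=> x y; rewrite /chi omega_umul // scalar_mxM.
Qed.

Lemma sum_U6 (n : nat) (V : nmodType) (F : U6 n -> V) :
  \sum_x F x = \sum_i \sum_e F (i, e).
Proof. by rewrite pair_bigA; apply: eq_bigr => -[]. Qed.

Lemma cube_root_sum (z : algC) (zP : 3.-primitive_root z) : 1 + z + z ^+ 2 = 0.
Proof.
have z1 : z - 1 != 0 by rewrite subr_eq0 -(expr1 z) -(prim_order_dvd zP).
apply: (mulfI z1); rewrite mulr0 [LHS](_ : _ = z ^+ 3 - 1); last by ring.
by rewrite (prim_expr_order zP) subrr.
Qed.

Lemma cube_root_mul (z : algC) (zP : 3.-primitive_root z)
    (e f : 'Z_3) (c : nat) :
  z ^+ ((e + f)%R * c) = z ^+ (e * c) * z ^+ (f * c).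
Proof.
by rewrite ![(_ * c)%N]mulnC -exprD -mulnDr mulnC exprM (prim_expr_mod zP)
   -exprM mulnC.
Qed.

(** Inverting [b] exchanges its two eigenvalues, as conjugation by the swap [P] does: this is the
    relation [a^-1 b a = b^-1] for [rho]. The product type lets both equations be used as one
    rewrite rule. *)
Lemma cube_root_opp (z : algC) (zP : 3.-primitive_root z) (e : 'Z_3) :
  (z ^+ ((- e)%R * 1) = z ^+ (e * 2)) * (z ^+ ((- e)%R * 2) = z ^+ (e * 1)).
Proof.
by split; apply/eqP; rewrite (eq_prim_root_expr zP);
  case: e => [[|[|[|//]]] ?].
Qed.

Lemma rho_rep (z : algC) (zP : 3.-primitive_root z) (n k : nat) :
  (0 < n)%N -> is_rep n 2 (rho n z k).
Proof.
move=> n0; split.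
  by apply/matrixP=> -[[|[|//]] ?] [[|[|//]] ?];
    rewrite !mxE /= ?muln0 ?mul0n ?mulr1.
move=> x y; apply/matrixP=> r c.
rewrite !mxE !big_ord_recl big_ord0 !mxE addr0 omega_umul // odd_umul //.
rewrite (cube_root_mul z zP).
case: r c => [[|[|//]] ?] [[|[|//]] ?] /=; rewrite /bump /=;
  case: (odd x.1); case: (odd y.1) => //=;
  rewrite ?(mul0r, mulr0, addr0, add0r) ?(cube_root_opp z zP) //; ring.
Qed.

Lemma tr_rho (z : algC) (zP : 3.-primitive_root z) (n k : nat) (x : U6 n) :
  \tr (rho n z k x) = psi k x.
Proof.
rewrite /mxtrace !big_ord_recl big_ord0 !mxE /= /psi addr0.
case: (odd x.1) => /=; first by rewrite addr0.
rewrite -mulrDr mulrC; congr (_ * _).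
have -> : -1 = z + z ^+ 2.
  apply/oppr_inj; rewrite opprK; apply/eqP.
  by rewrite -addr_eq0 addrA (cube_root_sum z zP).
case: x => _ [[|[|[|//]]] ?] //=; rewrite /bump /=.
by rewrite (_ : (2 * 2 = 3 + 1)%N) // exprD (prim_expr_order zP) mul1r addrC.
Qed.

(* Fourier inversion: the even and odd parts of [v] are seen separately by the
   matrix entries of [rho k], and recombine into discrete Fourier transforms
   at [k] and [k + n] because [omega ^+ n = -1]. *)
Lemma fourier_inj (z : algC) (zP : 3.-primitive_root z)
    (n : nat) (v : U6 n -> algC) : (0 < n)%N ->
  (forall j, (j < 2 * n)%N -> \sum_x v x * chi j x = 0) ->
  (forall k, (k < n)%N -> \sum_x v x *: rho n z k x = 0) ->
  forall x, v x = 0.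
Proof.
move=> n0 Hchi Hrho.
have wP := omega_prim n n0; have wP' := wP; rewrite -(Zp_card n n0) in wP'.
have wn : omega n ^+ n = -1 by rewrite /omega rootCK.
(* A transform in the [b]-coordinate alone: frequency 0 is seen by the linear characters,
   frequencies 1 and 2 by the two columns of [rho]. *)
suff H c : (c < 3)%N -> forall i, \sum_(e : 'Z_3) v (i, e) * z ^+ (c * e) = 0.
  move=> [i e]; exact: (dft_inj _ _ _ (fun e => v (i, e)) zP (fun c c3 => H c c3 i)).
case: c => [|c] c3.
  move=> i; under eq_bigr do rewrite mulr1.
  move: i; apply: (dft_inj _ _ _ _ wP') => j.
  rewrite [X in (_ < X)%N]Zp_card // => jn.
  rewrite -[RHS](Hchi _ jn) sum_U6.
  by apply: eq_bigr => l _; rewrite mulr_suml.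
pose h i := \sum_(e : 'Z_3) v (i, e) * z ^+ (c.+1 * e).
have Hpar b k : (k < n)%N ->
    \sum_(i : 'Z_(2 * n) | odd i == b) h i * omega n ^+ (k * i) = 0.
  (* In column [c], the entry in row [b (+) odd c] is supported exactly on the [x] with
     [odd x.1 == b]. *)
  move=> kn; have rP : (b (+) odd c < 2)%N by case: (_ (+) _).
  have /matrixP/(_ (Ordinal rP) (Ordinal (c3 : (c < 2)%N))) := Hrho k kn.
  rewrite summxE mxE sum_U6 => E.
  rewrite big_mkcond /= -[RHS]E; apply: eq_bigr => i _.
  transitivity (\sum_(e : 'Z_3) if odd i == b then
      v (i, e) * z ^+ (c.+1 * e) * omega n ^+ (k * i) else 0).
    by case: ifP => _; rewrite ?mulr_suml // big1.
  apply: eq_bigr => e _; rewrite !mxE /= oddD oddb -addbA addbb addbF eq_sym.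
  case: ifP => _; rewrite ?mulr0 // -mulrA; congr (_ * _).
  by rewrite mulrC [(e * _)%N]mulnC.
apply: (dft_inj _ _ _ h wP') => j; rewrite [X in (_ < X)%N]Zp_card // => jn.
have [k [kn jE]] : exists k, (k < n)%N /\ (j = k \/ j = k + n)%N.
  by have [jn'|jn'] := ltnP j n; [exists j|exists (j - n)%N]; lia.
(* The ratio of the frequencies [j] and [k] depends only on the parity of [i], so it factors out of
   each half-sum. *)
have [s sE] : exists s : bool -> algC, forall i : 'Z_(2 * n),
    omega n ^+ (j * i) = s (odd i) * omega n ^+ (k * i).
  case: jE => ->; first by exists (fun=> 1) => i; rewrite mul1r.
  exists (fun b : bool => (-1) ^+ b) => i.
  by rewrite signr_odd mulnDl exprD (exprM _ n) wn mulrC.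
have part b : \sum_(i : 'Z_(2 * n) | odd i == b) h i * omega n ^+ (j * i) = 0.
  rewrite -[RHS](mulr0 (s b)) -[X in _ = _ * X](Hpar b k kn) mulr_sumr.
  by apply: eq_bigr => i /eqP <-; rewrite sE mulrCA.
rewrite (bigID (fun i : 'I__ => odd i == true)) /= part add0r -[RHS](part false).
by apply: eq_bigl => i; case: odd.
Qed.

(** * Traces over [S] and the integrality criterion *)

Lemma big_Spart (n : nat) (S : {set U6 n}) (F : U6 n -> algC) :
  \sum_(x in S) F x = \sum_(x in Spart1 S) F x + \sum_(x in Spart2 S) F x.
Proof.
rewrite (bigID (fun x : U6 n => odd x.1)) addrC /=.
by congr (_ + _); apply: eq_bigl => x; rewrite inE.
Qed.

Lemma tr_rho_sum (n : nat) (z : algC) (k : nat) (S : {set U6 n}) :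
  3.-primitive_root z ->
  \tr (\sum_(s in S) rho n z k s) = cfset (psi k) (Spart1 S).
Proof.
move=> zP; rewrite raddf_sum /=; under eq_bigr do rewrite tr_rho //.
rewrite big_Spart [X in _ + X]big1 ?addr0 // => x.
by rewrite inE /psi => /andP[_ ->].
Qed.

(** Products mixing the two parts of [S] have an odd exponent of [a], where [psi k] vanishes. *)
Lemma tr_rho_sum_sqr (n : nat) (z : algC) (k : nat) (S : {set U6 n}) :
  (0 < n)%N -> 3.-primitive_root z ->
  \tr ((\sum_(s in S) rho n z k s) *m (\sum_(s in S) rho n z k s)) =
  cfsq (psi k) (Spart1 S) + cfsq (psi k) (Spart2 S).
Proof.
move=> n0 zP; have [_ rM] := rho_rep z zP n k n0.
transitivity (\sum_(x in S) \sum_(y in S) psi k (umul x y)).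
  rewrite mulmx_suml raddf_sum; apply: eq_bigr => x _ /=.
  rewrite mulmx_sumr raddf_sum; apply: eq_bigr => y _ /=.
  by rewrite -rM tr_rho.
rewrite big_Spart; congr (_ + _); apply: eq_bigr => x; rewrite inE => /andP[_ ox].
  rewrite big_Spart [X in _ + X]big1 ?addr0 // => y; rewrite inE => /andP[_ oy].
  by rewrite /psi odd_umul // (negPf ox) oy.
rewrite big_Spart big1 ?add0r // => y; rewrite inE => /andP[_ oy].
by rewrite /psi odd_umul // ox (negPf oy).
Qed.

Theorem theorem3p1 (n : nat) (S : {set U6 n}) :
  (0 < n)%N ->
  uone n \notin S ->
  uinvset S = S ->
  integral_cayley S <->
  ((forall j : 'I_(2 * n), cfset (chi j) S \in Num.int) /\
   (forall k : 'I_n,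
      cfset (psi k) (Spart1 S) \in Num.int /\
      cfsq (psi k) (Spart1 S) + cfsq (psi k) (Spart2 S) \in Num.int) /\
   (forall k : 'I_n, exists m : int,
      2 * (cfsq (psi k) (Spart1 S) + cfsq (psi k) (Spart2 S))
        - cfset (psi k) (Spart1 S) ^+ 2 = (m%:~R) ^+ 2)).
Proof.
move=> n0 _ _; have [z zP] := C_prim_root_exists (isT : (0 < 3)%N).
have chiE j a : eigenvalue (\sum_(s in S) (chi j s)%:M : 'M[algC]_1) a =
    (a == cfset (chi j) S).
  by rewrite eigenvalue_mx11 summxE; under eq_bigr do rewrite mxE.
have rhoE k := integral_mx22 (\sum_(s in S) rho n z k s).
split=> [intS | [Hchi [Hpsi Hsq]]].
  have Hrho (k : 'I_n) := (rhoE k).1 (fun a Ha => intS a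
      (eigenvalue_rep_cay n 2 _ S a (rho_rep z zP n k n0) Ha)).
  split=> [j|].
    apply: intS; apply: (eigenvalue_rep_cay n 1 _ S _ (chi_rep n j n0)).
    by rewrite chiE.
  by split=> k; have [] := Hrho k; rewrite tr_rho_sum // tr_rho_sum_sqr.
move=> a /eigenvalueP[v vA v0].
(* If [a] were not an integer, the first alternative would fail for every [chi j] and [rho k]; all
   transforms of [v] would then vanish, forcing [v = 0]. *)
have rep_case d (r : U6 n -> 'M[algC]_d) : is_rep n d r ->
    eigenvalue (\sum_(s in S) r s) a \/ \sum_x v 0 (enum_rank x) *: r x = 0.
  move=> rP; have [X0|X0] := eqVneq (\sum_i v 0 i *: r (enum_val i)) 0; [right|left].
    rewrite -[RHS]X0 (big_enum_val (A := {: U6 n})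
      (fun x => v 0 (enum_rank x) *: r x)) /=.
    by apply: eq_bigr => i _; rewrite enum_valK.
  exact: eigenvalue_cay_rep rP vA X0.
have [//|aN] := boolP (a \in Num.int); case/eqP: v0; apply/rowP => i.
rewrite mxE -(enum_valK i).
apply: (fourier_inj z zP n (fun x => v 0 (enum_rank x)) n0) => [j jn|k kn].
  have [|E] := rep_case _ _ (chi_rep n j n0).
    by rewrite chiE => /eqP aE; rewrite aE (Hchi (Ordinal jn)) in aN.
  have /matrixP/(_ 0 0) := E; rewrite summxE mxE => {}E; rewrite -[RHS]E.
  by apply: eq_bigr => x _; rewrite !mxE mulr1n.
have [Ea|//] := rep_case _ _ (rho_rep z zP n k n0).
case/negP: aN; move: a Ea {vA rep_case}; apply/(rhoE k).
rewrite tr_rho_sum // tr_rho_sum_sqr //.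
by split; [exact: (Hpsi (Ordinal kn))|exact: (Hsq (Ordinal kn))].
Qed.
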